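(* In the Markov Paging model, every dominating distribution algorithm $\mathcal{A}_{\mathrm{dom}}$ is $2$-competitive against $\mathrm{OPT}$: for every Markov Paging instance and every horizon $T \ge 1$, $$\mathbb{E}[\mathrm{cost}(\mathcal{A}_{\mathrm{dom}},T)] \le 2\,\mathbb{E}[\mathrm{cost}(\mathrm{OPT},T)].$$
   Context: Markov Paging model: there are $n$ pages in slow memory and a cache of size $k$. Page requests $p_1,p_2,\dots$ are drawn from a time-homogeneous Markov chain on the $n$ pages with initial distribution on the pages (e.g. uniform) and known transition matrix $M\in[0,1]^{n\times n}$, where $M_{i,j}$ is the probability that page $j$ is requested next given that page $i$ was the most recently requested page. The algorithm knows $M$ but not the realized request sequence. All algorithms start from the same initial cache of $k$ pages. At each time step, if the requested page is in the cache there is no cost; otherwise the algorithm suffers a cache miss (unit cost), must evict a page from its cache, and brings in the requested page. For a (possibly randomized) online eviction policy $\mathcal{A}$, $\mathrm{cost}(\mathcal{A},T)$ is the number of cache misses among the first $T$ requests, and the expectation is over the request sequence and the algorithm's randomness. $\mathrm{OPT}$ is the online policy minimizing $\mathbb{E}[\mathrm{cost}(\mathcal{A},T)]$. A policy $\mathcal{A}$ is $c$-competitive against $\mathrm{OPT}$ if $\mathbb{E}[\mathrm{cost}(\mathcal{A},T)]\le c\,\mathbb{E}[\mathrm{cost}(\mathrm{OPT},T)]$ for every $T$. Dominating distribution algorithm: for pages $p\neq q$ and a page $s$, let $\alpha(p<q\mid s)$ be the probability (over the Markov chain) that $p$ is next requested before $q$, given that $s$ is the most recently requested page; set $\alpha(p<p\mid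 s)=0$. Whenever the algorithm suffers a cache miss on a request to page $s$, it chooses a probability distribution $\mu$ over the pages currently in its cache such that for every page $q$ in the cache, $\sum_{p \text{ in cache}}\mu(p)\,\alpha(p<q\mid s)\le \tfrac12$ (such a $\mu$ always exists), draws $p\sim\mu$, and evicts $p$. Any algorithm following this rule (with any valid choice of $\mu$) is called a dominating distribution algorithm. *)

(* Defs.v *)
From HB Require Import structures.
From mathcomp Require Import all_boot all_order all_algebra.
From mathcomp Require Import all_classical all_reals all_analysis.
Set Implicit Arguments.
Unset Strict Implicit.
Unset Printing Implicit Defensive.
Import Order.TTheory GRing.Theory Num.Theory numFieldNormedType.Exports.

Local Open Scope ring_scope.

(* Pages are the elements of 'I_n.  A miss has to evict a page, hence 0 < k. *)
Record markov_paging (R : realType) (n k : nat) := MarkovPaging {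
  init : 'I_n -> R;
  trans : 'M[R]_n;
  cache0 : {set 'I_n};
  init_ge0 : forall i, 0 <= init i;
  init_sum1 : \sum_i init i = 1;
  trans_ge0 : forall i j, 0 <= trans i j;
  trans_sum1 : forall i, \sum_j trans i j = 1;
  card_cache0 : #|cache0| = k;
  cache_size_gt0 : (0 < k)%N
}.

(* One time step: the requested page, and the page evicted to serve it (None
   on a hit).  Histories list the most recent step first. *)
Definition step (n : nat) : finType := ('I_n * option 'I_n)%type.
Definition history (n : nat) := seq (step n).

Fixpoint cache (R : realType) (n k : nat) (I : markov_paging R n k)
    (h : history n) : {set 'I_n} :=
  match h with
  | [::] => cache0 I
  | (_, None) :: h' => cache I h'
  | (s, Some p) :: h' => s |: (cache I h' :\ p)
  end.

(* The histories that can be produced by some eviction policy: a page is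
   evicted exactly on the misses, and it is taken from the current cache. *)
Fixpoint feasible (R : realType) (n k : nat) (I : markov_paging R n k)
    (h : history n) : bool :=
  match h with
  | [::] => true
  | (s, None) :: h' => feasible I h' && (s \in cache I h')
  | (s, Some p) :: h' =>
      [&& feasible I h', s \notin cache I h' & p \in cache I h']
  end.

(* A randomized policy in behavioural form: A h s p is the conditional
   probability of evicting p when the request to s, arriving after the history
   h, is a miss.  It depends on the past requests and on the past evictions. *)
Definition policy (R : realType) (n : nat) := history n -> 'I_n -> 'I_n -> R.

Definition is_distr_on (R : realType) (n : nat) (C : {set 'I_n})
    (mu : 'I_n -> R) : Prop :=
  [/\ forall p, 0 <= mu p,
      forall p, p \notin C -> mu p = 0
    & \sum_(p in C) mu p = 1].

Definition online_policy (R : realType) (n k : nat) (I : markov_paging R n k)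
    (A : policy R n) : Prop :=
  forall h s, feasible I h -> s \notin cache I h ->
    is_distr_on (cache I h) (A h s).

Definition request_prob (R : realType) (n k : nat) (I : markov_paging R n k)
    (h : history n) (s : 'I_n) : R :=
  match h with
  | [::] => init I s
  | (r, _) :: _ => trans I r s
  end.

Definition eviction_prob (R : realType) (n k : nat) (I : markov_paging R n k)
    (A : policy R n) (h : history n) (s : 'I_n) (e : option 'I_n) : R :=
  match e with
  | None => (s \in cache I h)%:R
  | Some p => if s \in cache I h then 0 else A h s p
  end.

Fixpoint run_prob (R : realType) (n k : nat) (I : markov_paging R n k)
    (A : policy R n) (h : history n) : R :=
  match h with
  | [::] => 1
  | (s, e) :: h' =>
      run_prob I A h' * (request_prob I h' s * eviction_prob I A h' s e)
  end.

Fixpoint misses (R : realType) (n k : nat) (I : markov_paging R n k)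
    (h : history n) : nat :=
  match h with
  | [::] => 0%N
  | (s, _) :: h' => (misses I h' + (s \notin cache I h'))%N
  end.

Definition expected_cost (R : realType) (n k : nat) (I : markov_paging R n k)
    (A : policy R n) (T : nat) : R :=
  \sum_(h : T.-tuple (step n)) run_prob I A h * (misses I h)%:R.

Definition is_OPT (R : realType) (n k : nat) (I : markov_paging R n k)
    (T : nat) (O : policy R n) : Prop :=
  online_policy I O /\
  forall B, online_policy I B -> expected_cost I O T <= expected_cost I B T.

(* The optimal online policy is the one for the horizon T at hand; it exists
   for each T, see OPT_exists. *)
Definition competitive (R : realType) (n k : nat) (I : markov_paging R n k)
    (c : R) (A : policy R n) : Prop :=
  forall T, (0 < T)%N -> forall OPT, is_OPT I T OPT ->
    expected_cost I A T <= c * expected_cost I OPT T.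

(* The probability that the requests following a request to s start with x,
   in chronological order. *)
Fixpoint path_prob (R : realType) (n k : nat) (I : markov_paging R n k)
    (s : 'I_n) (x : seq 'I_n) : R :=
  match x with
  | [::] => 1
  | y :: x' => trans I s y * path_prob I y x'
  end.

(* The probability that, among the t requests following a request to s, p
   occurs, and occurs before any occurrence of q.  Recall that index p x is
   size x when p does not occur in x. *)
Definition alpha_within (R : realType) (n k : nat) (I : markov_paging R n k)
    (p q s : 'I_n) (t : nat) : R :=
  \sum_(x : t.-tuple 'I_n | (index p x < index q x)%N) path_prob I s x.

(* alpha(p < q | s).  The event "p is next requested before q" is the
   increasing union over t of the events of alpha_within; the limit exists by
   cvg_alpha_within. *)
Definition alpha (R : realType) (n k : nat) (I : markov_paging R n k)
    (p q s : 'I_n) : R :=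
  limn (alpha_within I p q s).

Definition dominating_distr (R : realType) (n k : nat)
    (I : markov_paging R n k) (C : {set 'I_n}) (s : 'I_n)
    (mu : 'I_n -> R) : Prop :=
  is_distr_on C mu /\
  forall q, q \in C -> \sum_(p in C) mu p * alpha I p q s <= 1 / 2.

Definition dominating_distribution_algorithm (R : realType) (n k : nat)
    (I : markov_paging R n k) (A : policy R n) : Prop :=
  forall h s, feasible I h -> s \notin cache I h ->
    dominating_distr I (cache I h) s (A h s).

Lemma path_prob_ge0 (R : realType) (n k : nat) (I : markov_paging R n k)
  (s : 'I_n) (x : seq 'I_n) : 0 <= path_prob I s x.
Proof. by elim: x s => //= y x IH s; rewrite mulr_ge0 ?trans_ge0. Qed.

Lemma sum_tupleS (V : nmodType) (X : finType) (t : nat) (F : seq X -> V) :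
  \sum_(x : t.+1.-tuple X) F x = \sum_(x : t.-tuple X) \sum_y F (y :: x).
Proof.
rewrite pair_big /=.
rewrite (reindex (fun u : (t.-tuple X * X)%type => [tuple of u.2 :: u.1])) //=.
exists (fun x : t.+1.-tuple X => ([tuple of behead x], thead x)).
  by move=> [x y] _ /=; congr pair; apply/val_inj.
by move=> x _ /=; rewrite -tuple_eta.
Qed.

Lemma alpha_withinS (R : realType) (n k : nat) (I : markov_paging R n k)
    (p q s : 'I_n) (t : nat) :
  alpha_within I p q s t.+1 =
  \sum_y trans I s y *
    (if y == q then 0 else if y == p then \sum_(x : t.-tuple 'I_n) path_prob I y x
     else alpha_within I p q y t).
Proof.
rewrite /alpha_within big_mkcond /=.
rewrite (sum_tupleS _ (fun x : seq 'I_n =>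
  if (index p x < index q x)%N then path_prob I s x else 0)).
rewrite exchange_big /=; apply: eq_bigr => y _.
case: (eqVneq y q) => [_|yq].
  by rewrite mulr0; apply: big1.
case: (eqVneq y p) => [_|yp]; first by rewrite /= mulr_sumr.
by rewrite mulr_sumr [RHS]big_mkcond /=; apply: eq_bigr => x _; rewrite ltnS.
Qed.

Lemma path_prob_sum1 (R : realType) (n k : nat) (I : markov_paging R n k)
  (s : 'I_n) (t : nat) : \sum_(x : t.-tuple 'I_n) path_prob I s x = 1.
Proof.
elim: t s => [|t IH] s.
  rewrite (big_pred1 [tuple]) // => x; apply/esym/eqP; exact: tuple0.
rewrite (sum_tupleS _ (path_prob I s)) exchange_big /= -[RHS](trans_sum1 I s).
by apply: eq_bigr => y _; rewrite -mulr_sumr IH mulr1.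
Qed.

Lemma alpha_within_nd (R : realType) (n k : nat) (I : markov_paging R n k)
  (p q s : 'I_n) (t : nat) : alpha_within I p q s t <= alpha_within I p q s t.+1.
Proof.
elim: t s => [|t IH] s.
  rewrite {1}/alpha_within big1 => [|x]; last by rewrite tuple0.
  by rewrite /alpha_within sumr_ge0// => x _; rewrite path_prob_ge0.
rewrite !alpha_withinS ler_sum// => y _; apply: ler_wpM2l; first exact: trans_ge0.
by case: ifP => // _; case: ifP => // _; rewrite !path_prob_sum1.
Qed.

Lemma cvg_alpha_within (R : realType) (n k : nat) (I : markov_paging R n k)
  (p q s : 'I_n) : cvgn (alpha_within I p q s).
Proof.
apply: nondecreasing_is_cvgn.
  by apply/nondecreasing_seqP => t; exact: alpha_within_nd.
exists 1 => _ [t _ <-]; rewrite -(path_prob_sum1 I s t) /alpha_within.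
rewrite [leRHS](bigID (fun x : t.-tuple 'I_n => index p x < index q x)%N) /=.
by rewrite lerDl sumr_ge0// => x _; rewrite path_prob_ge0.
Qed.

Lemma card_cache (R : realType) (n k : nat) (I : markov_paging R n k)
  (h : history n) : feasible I h -> #|cache I h| = k.
Proof.
elim: h => [_|[s [p|]] h IH] /=; first exact: card_cache0.
  case/and3P => fh sh ph; rewrite cardsU1 in_setD1 (negbTE sh) andbF /=.
  by have := IH fh; rewrite (cardsD1 p (cache I h)) ph.
by case/andP => fh _; exact: IH.
Qed.

Lemma online_policy_run_prob (R : realType) (n k : nat)
    (I : markov_paging R n k) (A : policy R n) (h : history n) :
  online_policy I A ->
  0 <= run_prob I A h /\ (~~ feasible I h -> run_prob I A h = 0).
Proof.
move=> Aon; elim: h => [|[s e] h [IH0 IH]] /=; first by rewrite ler01.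
case fh: (feasible I h); last first.
  by rewrite IH ?fh// mul0r.
have req_ge0 : 0 <= request_prob I h s.
  by case: {+}h => [|[r e'] h'] /=; [exact: init_ge0|exact: trans_ge0].
case: e => [p|] /=.
  case sh: (s \in cache I h) => /=; first by rewrite !mulr0.
  have [A0 Asupp _] := Aon h s fh (negbT sh).
  split; first by rewrite !mulr_ge0.
  by move/Asupp => ->; rewrite !mulr0.
by split; [rewrite !mulr_ge0|move/negbTE => ->; rewrite !mulr0].
Qed.

Definition best_in (R : realType) (n : nat) (C : {set 'I_n}) (f : 'I_n -> R)
    (d : 'I_n) : 'I_n :=
  if [pick p in C] is Some p0 then [arg min_(p < p0 in C) f p]%O else d.

Lemma best_inP (R : realType) (n : nat) (C : {set 'I_n}) (f : 'I_n -> R)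
    (d : 'I_n) : C != finset.set0 ->
  best_in C f d \in C /\ forall p, p \in C -> f (best_in C f d) <= f p.
Proof.
move=> C0; rewrite /best_in; case: pickP => [p0 p0C|C_empty].
  by case: arg_minP => // p pC pmin.
by case/set0Pn: C0 => p; rewrite C_empty.
Qed.

(* The least expected total cost of a run that starts with h and goes on for m
   more steps, given by backward induction. *)
Fixpoint opt_value (R : realType) (n k : nat) (I : markov_paging R n k)
    (m : nat) (h : history n) : R :=
  match m with
  | 0 => (misses I h)%:R
  | m'.+1 =>
      \sum_s request_prob I h s *
        (if s \in cache I h then opt_value I m' ((s, None) :: h)
         else let v p := opt_value I m' ((s, Some p) :: h) in
              v (best_in (cache I h) v s))
  end.

Definition opt_policy (R : realType) (n k : nat) (I : markov_paging R n k)
    (T : nat) : policy R n := fun h s p =>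
  (p == best_in (cache I h)
          (fun p => opt_value I (T - (size h).+1) ((s, Some p) :: h)) s)%:R.

Lemma opt_policy_online (R : realType) (n k : nat) (I : markov_paging R n k)
  (T : nat) : online_policy I (opt_policy I T).
Proof.
move=> h s fh sh.
have C0 : cache I h != finset.set0.
  by rewrite -card_gt0 card_cache// (cache_size_gt0 I).
have [bC _] := best_inP (fun p =>
  opt_value I (T - (size h).+1) ((s, Some p) :: h)) s C0.
rewrite /opt_policy; set b := best_in _ _ _ in bC *; split.
- by move=> p; rewrite ler0n.
- by move=> p pC; case: eqP => // pb; move: pC; rewrite pb bC.
rewrite (bigD1 b) //= eqxx big1 ?addr0// => p /andP[_ /negbTE ->] //.
Qed.

Lemma sum_step (R : realType) (n k : nat) (I : markov_paging R n k)
    (A : policy R n) (h : history n) (F : history n -> R) :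
  online_policy I A -> feasible I h ->
  \sum_(y : step n) run_prob I A (y :: h) * F (y :: h) =
  run_prob I A h * \sum_s request_prob I h s *
    (if s \in cache I h then F ((s, None) :: h)
     else \sum_(p in cache I h) A h s p * F ((s, Some p) :: h)).
Proof.
move=> Aon fh; rewrite mulr_sumr.
transitivity (\sum_s \sum_e run_prob I A ((s, e) :: h) * F ((s, e) :: h)).
  by rewrite pair_bigA; apply: eq_bigr => -[s e] _.
apply: eq_bigr => s _ /=.
rewrite (bigD1 None) //= (reindex_omap Some id) /=; last by case.
under eq_bigl => p do rewrite eqxx.
case: ifP => sh.
  by rewrite big1 ?addr0 ?mulr1 -?mulrA// => p _; rewrite !mulr0 mul0r.
rewrite !mulr0 mul0r add0r.
rewrite [LHS](bigID (fun p => p \in cache I h)) /= [X in _ + X]big1 ?addr0.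
  by rewrite !mulr_sumr; apply: eq_bigr => p _; rewrite !mulrA.
have [_ Asupp _] := Aon h s fh (negbT sh).
by move=> p /Asupp ->; rewrite !mulr0 mul0r.
Qed.

Lemma OPT_exists (R : realType) (n k : nat) (I : markov_paging R n k)
  (T : nat) : exists O, is_OPT I T O.
Proof.
pose S (A : policy R n) j :=
  \sum_(h : j.-tuple (step n)) run_prob I A h * opt_value I (T - j) h.
have S0 A : S A 0%N = opt_value I T [::].
  rewrite /S (big_pred1 [tuple]) /= ?subn0 ?mul1r// => x.
  by apply/esym/eqP; exact: tuple0.
have ST A : S A T = expected_cost I A T by rewrite /S subnn.
have SE A j : S A j.+1 = \sum_(h : j.-tuple (step n)) \sum_(y : step n)
    run_prob I A (y :: h) * opt_value I (T - j.+1) (y :: h).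
  exact: (sum_tupleS _ (fun h => run_prob I A h * opt_value I (T - j.+1) h)).
have lower A : online_policy I A -> forall j, (j <= T)%N -> S A 0%N <= S A j.
  move=> Aon; elim=> // j IH jT; apply: (le_trans (IH (ltnW jT))).
  rewrite SE; apply: ler_sum => h _.
  case fh: (feasible I h); last first.
    have [_ ->] := online_policy_run_prob h Aon; last by rewrite fh.
    rewrite mul0r sumr_ge0// => -[s e] _ /=.
    by have [_ ->] := online_policy_run_prob h Aon; rewrite ?fh// !mul0r.
  rewrite (sum_step (fun h => opt_value I (T - j.+1) h) Aon fh).
  have -> : (T - j = (T - j.+1).+1)%N by rewrite subnSK.
  apply: ler_wpM2l; first by have [] := online_policy_run_prob h Aon.
  rewrite /= ler_sum// => s _; apply: ler_wpM2l.
    case: {+}(val h) => [|[r e'] h'] /=; [exact: init_ge0|exact: trans_ge0].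
  case: ifP => // /negbT sh.
  have C0 : cache I h != finset.set0.
    by rewrite -card_gt0 card_cache// (cache_size_gt0 I).
  set v := fun p => opt_value _ _ _.
  have [_ bmin] := best_inP v s C0.
  have [A0 _ A1] := Aon h s fh sh.
  rewrite -[leLHS]mul1r -A1 mulr_suml ler_sum// => p pC.
  by apply: ler_wpM2l; [exact: A0|exact: bmin].
have Oon : online_policy I (opt_policy I T) by exact: opt_policy_online.
have optimal j : (j <= T)%N -> S (opt_policy I T) j = opt_value I T [::].
  elim: j => [|j IH] jT; first exact: S0.
  rewrite -(IH (ltnW jT)) SE; apply: eq_bigr => h _.
  case fh: (feasible I h); last first.
    have [_ ->] := online_policy_run_prob h Oon; last by rewrite fh.
    rewrite mul0r big1// => -[s e] _ /=.
    by have [_ ->] := online_policy_run_prob h Oon; rewrite ?fh// !mul0r.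
  rewrite (sum_step (fun h => opt_value I (T - j.+1) h) Oon fh).
  have -> : (T - j = (T - j.+1).+1)%N by rewrite subnSK.
  congr (_ * _) => /=; apply: eq_bigr => s _; congr (_ * _).
  case: ifP => // /negbT sh.
  have C0 : cache I h != finset.set0.
    by rewrite -card_gt0 card_cache// (cache_size_gt0 I).
  rewrite /opt_policy size_tuple; set v := fun p => opt_value _ _ _.
  have [bC _] := best_inP v s C0.
  rewrite (bigD1 (best_in (cache I h) v s)) //= eqxx mul1r big1 ?addr0//.
  by move=> p /andP[_ /negbTE ->]; rewrite mul0r.
exists (opt_policy I T); split => // B Bon.
by rewrite -!ST optimal// -(S0 B) lower.
Qed.

(* Main.v *)
(* Match the pages missing from the cache A of the dominating distribution
   algorithm with those missing from the cache of OPT by a bijection f, and let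
   Phi be twice the sum of alpha(p < f p | s) over the pages p missing from A.
   Between two requests Phi is a martingale.  Since alpha satisfies the triangle
   inequality in (p, q), the matching can be made to fix the pages missing from
   both caches without increasing Phi.  When OPT misses s and evicts r, the page
   matched with s is rematched with r, which costs at most 2 in Phi.  When only
   A misses s, the term of s falls from 2 to at most 2 * 1/2 on average, the
   evicted page p being matched with f s, which A has in its cache; this pays for
   the miss.  When both miss, s is matched with itself, and p is matched with r,
   or with f r if A does not have r either, which adds at most 1 to Phi on
   average.  Given the request, the choices of the two policies can be averaged
   separately, so no coupling is needed: the bound holds for the costs to go from
   any two histories with the same last request and any matching. *)
Require Import Defs.
From mathcomp Require Import all_boot all_order all_algebra.
From mathcomp Require Import all_fingroup lra.
From mathcomp Require Import all_classical all_reals all_analysis.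
Import Order.TTheory GRing.Theory Num.Theory numFieldNormedType.Exports.
Local Open Scope ring_scope.

Set Implicit Arguments.
Unset Strict Implicit.
Unset Printing Implicit Defensive.

(** * The order probabilities [alpha]: triangle inequality, bounds, recursion *)

(** It holds on each request sequence: if [p] comes before [r], then [q] comes after [p] or before
    [r]. *)
Lemma alpha_within_triangle (R : realType) (n k : nat)
    (I : markov_paging R n k) (p q r s : 'I_n) (t : nat) :
  alpha_within I p r s t <= alpha_within I p q s t + alpha_within I q r s t.
Proof.
rewrite /alpha_within !(big_mkcond (fun x : t.-tuple 'I_n => (_ < _)%N)) /=.
rewrite -big_split ler_sum//= => x _.
have x0 := path_prob_ge0 I s x.
case: ifP => pr; last by rewrite addr_ge0//; case: ifP.
case: ltnP => pq; first by rewrite lerDl; case: ifP.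
by rewrite (leq_ltn_trans pq pr) add0r.
Qed.

Lemma alpha_triangle (R : realType) (n k : nat) (I : markov_paging R n k)
    (p q r s : 'I_n) :
  alpha I p r s <= alpha I p q s + alpha I q r s.
Proof.
rewrite /alpha -limD; try exact: cvg_alpha_within.
apply: ler_lim.
- exact: cvg_alpha_within.
- by apply: is_cvgD; exact: cvg_alpha_within.
by apply: nearW => t; exact: alpha_within_triangle.
Qed.

Lemma alpha_within_ge0 (R : realType) (n k : nat) (I : markov_paging R n k)
    (p q s : 'I_n) (t : nat) : 0 <= alpha_within I p q s t.
Proof. by rewrite sumr_ge0// => x _; exact: path_prob_ge0. Qed.

Lemma alpha_within_le1 (R : realType) (n k : nat) (I : markov_paging R n k)
    (p q s : 'I_n) (t : nat) : alpha_within I p q s t <= 1.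
Proof.
rewrite -(path_prob_sum1 I s t) /alpha_within.
rewrite [leRHS](bigID (fun x : t.-tuple 'I_n => index p x < index q x)%N) /=.
by rewrite lerDl sumr_ge0// => x _; rewrite path_prob_ge0.
Qed.

Lemma alpha_ge0 (R : realType) (n k : nat) (I : markov_paging R n k)
    (p q s : 'I_n) : 0 <= alpha I p q s.
Proof.
apply: limr_ge; first exact: cvg_alpha_within.
by apply: nearW => t; exact: alpha_within_ge0.
Qed.

Lemma alpha_le1 (R : realType) (n k : nat) (I : markov_paging R n k)
    (p q s : 'I_n) : alpha I p q s <= 1.
Proof.
apply: limr_le; first exact: cvg_alpha_within.
by apply: nearW => t; exact: alpha_within_le1.
Qed.

Lemma alpha_refl (R : realType) (n k : nat) (I : markov_paging R n k)
    (p s : 'I_n) : alpha I p p s = 0.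
Proof.
have -> : alpha I p p s = limn (fun=> 0 : R).
  congr (limn _); apply/funext => t.
  by rewrite /alpha_within big_pred0// => x; rewrite ltnn.
exact: lim_cst.
Qed.

(* alpha(p < q) once the request to s is known, s itself being included among
   the requests that are looked at. *)
Definition alpha_from (R : realType) (n k : nat) (I : markov_paging R n k)
    (s p q : 'I_n) : R :=
  if s == q then 0 else if s == p then 1 else alpha I p q s.

Lemma alpha_from_ge0 (R : realType) (n k : nat) (I : markov_paging R n k)
    (s p q : 'I_n) : 0 <= alpha_from I s p q.
Proof.
by rewrite /alpha_from; case: ifP => // _; case: ifP => // _; exact: alpha_ge0.
Qed.

Lemma alpha_from_refl (R : realType) (n k : nat) (I : markov_paging R n k)
    (s p : 'I_n) : alpha_from I s p p = 0.
Proof. by rewrite /alpha_from alpha_refl; case: eqP. Qed.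

(** Condition on the next request, in the limit of [alpha_withinS]; this is the martingale property
    of the potential. *)
Lemma alphaE (R : realType) (n k : nat) (I : markov_paging R n k)
    (p q r : 'I_n) :
  alpha I p q r = \sum_s trans I r s * alpha_from I s p q.
Proof.
apply/cvg_lim => //; rewrite -(cvg_shiftS (alpha_within I p q r)) /=.
under eq_fun do rewrite alpha_withinS.
apply: cvg_big => [|s _]; first exact: add_continuous.
apply: cvgMl_tmp.
rewrite /alpha_from; case: ifP => _; first exact: cvg_cst.
case: ifP => _; last exact: cvg_alpha_within.
under eq_fun do rewrite path_prob_sum1.
exact: cvg_cst.
Qed.

(** * Expected cost by backward recursion *)

(** Unlike [opt_value], this leaves out the misses already made in [h], so that histories with
    different pasts can be compared. *)
Fixpoint cost_to_go (R : realType) (n k : nat) (I : markov_paging R n k)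
    (A : policy R n) (m : nat) (h : history n) : R :=
  match m with
  | 0 => 0
  | m'.+1 =>
      \sum_s request_prob I h s *
        (if s \in cache I h then cost_to_go I A m' ((s, None) :: h)
         else 1 + \sum_(p in cache I h)
                    A h s p * cost_to_go I A m' ((s, Some p) :: h))
  end.

Lemma request_prob_sum1 (R : realType) (n k : nat) (I : markov_paging R n k)
    (h : history n) : \sum_s request_prob I h s = 1.
Proof.
by case: h => [|[r e] h] /=; [exact: init_sum1|exact: trans_sum1].
Qed.

Lemma expected_cost_to_go (R : realType) (n k : nat)
    (I : markov_paging R n k) (A : policy R n) (T : nat) :
  online_policy I A -> expected_cost I A T = cost_to_go I A T [::].
Proof.
move=> Aon.
pose F j (h : history n) : R := (misses I h)%:R + cost_to_go I A (T - j) h.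
(* The expectation after [j] steps of the misses so far plus the cost to go does not depend on
   [j]. *)
pose S j := \sum_(h : j.-tuple (step n)) run_prob I A h * F j h.
have S0 : S 0%N = cost_to_go I A T [::].
  rewrite /S /F (big_pred1 [tuple]) /= ?subn0 ?mul1r ?add0r// => x.
  by apply/esym/eqP; exact: tuple0.
have ST : S T = expected_cost I A T.
  by apply: eq_bigr => h _; rewrite /F subnn addr0.
suff Sj j : (j <= T)%N -> S j = S 0%N by rewrite -ST Sj.
elim: j => // j IH jT; rewrite -(IH (ltnW jT)).
rewrite /S (sum_tupleS _ (fun h => run_prob I A h * F j.+1 h)).
apply: eq_bigr => h _.
case fh: (feasible I h); last first.
  have [_ ->] := online_policy_run_prob h Aon; last by rewrite fh.
  rewrite mul0r big1// => -[s e] _ /=.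
  by have [_ ->] := online_policy_run_prob h Aon; rewrite ?fh// !mul0r.
rewrite (sum_step (F j.+1) Aon fh); congr (_ * _).
rewrite /F -(subnSK jT) /= -[X in X + _]mul1r.
rewrite -[X in X * _ + _](request_prob_sum1 I h).
rewrite mulr_suml -big_split /=; apply: eq_bigr => s _; rewrite -mulrDr.
congr (_ * _); case sh: (s \in cache I h) => /=; first by rewrite addn0.
have [_ _ A1] := Aon h s fh (negbT sh).
under eq_bigr => p _ do rewrite mulrDr.
by rewrite big_split /= -mulr_suml A1 mul1r natrD addrA.
Qed.

(** * Matchings between the missing pages *)

(* Only the values of [f] outside A matter: they pair the pages missing from A
   with the pages missing from O. *)
Definition matching (n : nat) (A O : {set 'I_n}) (f : {perm 'I_n}) : Prop :=
  forall x, (f x \in O) = (x \in A).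

Definition matching_cost (R : realType) (n : nat) (c : 'I_n -> 'I_n -> R)
    (A : {set 'I_n}) (f : {perm 'I_n}) : R := \sum_(x | x \notin A) c x (f x).

Lemma matching_tperm (n : nat) (A O : {set 'I_n}) (f : {perm 'I_n})
    (x y : 'I_n) :
  matching A O f -> x \notin A -> y \notin A ->
  matching A O (tperm x y * f)%g.
Proof.
move=> fAO xA yA z; rewrite permM fAO.
by case: tpermP => // ->; rewrite (negbTE xA) (negbTE yA).
Qed.

(* If f maps y to x and x to z, with x missing from both caches, then mapping y
   to z and x to itself is not costlier, by the triangle inequality. *)
Lemma matching_fix (R : realType) (n : nat) (c : 'I_n -> 'I_n -> R)
    (A O : {set 'I_n}) (f : {perm 'I_n}) :
    (forall x, c x x = 0) -> (forall x y z, c x z <= c x y + c y z) ->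
    matching A O f ->
  exists g, [/\ matching A O g,
    forall x, x \notin A -> x \notin O -> g x = x
    & matching_cost c A g <= matching_cost c A f].
Proof.
move=> c0 ctri; have [m] := ubnP #|[set x | f x != x]|.
elim: m f => // m IH f mf fAO.
have [x /and3P[xA xO fx]|fixed] := pickP (fun x =>
    [&& x \notin A, x \notin O & f x != x]); last first.
  exists f; split=> // x xA xO; apply/eqP.
  by have := fixed x; rewrite xA xO /= => /negbFE.
pose y := (f^-1)%g x; have fy : f y = x by rewrite permKV.
have yA : y \notin A by rewrite -fAO fy.
have yx : y != x by apply: contraNneq fx => yx; rewrite -{1}yx fy.
pose g : {perm 'I_n} := (tperm x y * f)%g.
have gx : g x = x by rewrite permM tpermL.
have gy : g y = f x by rewrite permM tpermR.
have gE z : z != x -> z != y -> g z = f z.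
  by move=> zx zy; rewrite permM tpermD// eq_sym.
have [||g' [g'AO g'fix g'le]] := IH g.
(* The swap fixes [x] and moves no new page, since [f] already moved [y]. *)
- rewrite ltnS in mf; apply: leq_trans mf; apply: proper_card.
  apply/properP; split; last by exists x; rewrite !inE ?gx ?eqxx.
  apply/fintype.subsetP => z; rewrite !inE.
  have [->|zx] := eqVneq z x; first by rewrite gx eqxx.
  have [->|zy] := eqVneq z y; first by move=> _; rewrite fy eq_sym.
  by rewrite gE.
- exact: matching_tperm.
exists g'; split=> //; apply: (le_trans g'le).
rewrite /matching_cost (bigD1 x)// (bigD1 y) ?yA//=.
rewrite [leRHS](bigD1 x)// [X in _ <= _ + X](bigD1 y) ?yA//=.
rewrite gx gy fy c0 add0r addrA lerD//.
  by rewrite addrC; exact: ctri.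
by apply: ler_sum => z /andP[/andP[_ zx] zy]; rewrite gE.
Qed.

(** Replacing [p] by [s] acts on the cache as a transposition, so matchings are updated by composing
    permutations. *)
Lemma mem_replace (n : nat) (A : {set 'I_n}) (s p x : 'I_n) :
  s \notin A -> p \in A -> (x \in s |: (A :\ p)) = (tperm s p x \in A).
Proof.
move=> sA pA; rewrite !inE.
case: tpermP => [->|->|/eqP xs /eqP xp]; first by rewrite eqxx.
  by rewrite (negbTE sA) eqxx orbF; apply: contraNF sA => /eqP <-.
by rewrite (negbTE xs) xp.
Qed.

Lemma matching_replace (n : nat) (A O : {set 'I_n}) (s p r : 'I_n)
    (f : {perm 'I_n}) :
  matching A O f -> s \notin A -> p \in A -> s \notin O -> r \in O ->
  matching (s |: (A :\ p)) (s |: (O :\ r)) (tperm s p * f * tperm s r)%g.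
Proof.
by move=> fAO sA pA sO rO x; rewrite !mem_replace// !permM tpermK fAO.
Qed.

Lemma matching_replacel (n : nat) (A O : {set 'I_n}) (s p : 'I_n)
    (f : {perm 'I_n}) :
  matching A O f -> s \notin A -> p \in A ->
  matching (s |: (A :\ p)) O (tperm s p * f)%g.
Proof. by move=> fAO sA pA x; rewrite mem_replace// permM fAO. Qed.

Lemma matching_replacer (n : nat) (A O : {set 'I_n}) (s r : 'I_n)
    (f : {perm 'I_n}) :
  matching A O f -> s \notin O -> r \in O ->
  matching A (s |: (O :\ r)) (f * tperm s r)%g.
Proof. by move=> fAO sO rO x; rewrite mem_replace// permM tpermK fAO. Qed.

Lemma matching_cost_replace (R : realType) (n : nat) (c : 'I_n -> 'I_n -> R)
    (A : {set 'I_n}) (s p : 'I_n) (f : {perm 'I_n}) :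
  s \notin A -> p \in A ->
  matching_cost c (s |: (A :\ p)) f =
  c p (f p) + \sum_(x | (x \notin A) && (x != s)) c x (f x).
Proof.
move=> sA pA; rewrite /matching_cost (bigD1 p) /=; last first.
  by rewrite !inE eqxx orbF; apply: contraNneq sA => <-.
congr (_ + _); apply: eq_bigl => x; rewrite !inE negb_or negb_and negbK.
have [->|xp] := eqVneq x p; first by rewrite pA andbF.
by rewrite andbT andbC.
Qed.

(** * Averaging over the evicted page *)

Lemma le_distr_mean (R : realType) (n : nat) (C : {set 'I_n})
    (mu f : 'I_n -> R) (b : R) :
  is_distr_on C mu -> (forall p, p \in C -> b <= f p) ->
  b <= \sum_(p in C) mu p * f p.
Proof.
move=> [mu0 _ mu1] bf; rewrite -[leLHS]mul1r -mu1 mulr_suml.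
by apply: ler_sum => p pC; apply: ler_wpM2l; [exact: mu0|exact: bf].
Qed.

(** The weight 2 of the potential meets the bound 1/2 of the domination condition. *)
Lemma dominating_mean_le (R : realType) (n k : nat) (I : markov_paging R n k)
    (C : {set 'I_n}) (s q : 'I_n) (mu f : 'I_n -> R) (b : R) :
  dominating_distr I C s mu -> q \in C ->
  (forall p, p \in C -> f p <= b + 2 * alpha I p q s) ->
  \sum_(p in C) mu p * f p <= b + 1.
Proof.
move=> [[mu0 _ mu1] /(_ q) dom] qC fb; have {}dom := dom qC.
apply: (@le_trans _ _ (\sum_(p in C) mu p * (b + 2 * alpha I p q s))).
  by apply: ler_sum => p pC; apply: ler_wpM2l; [exact: mu0|exact: fb].
under eq_bigr => p _ do rewrite mulrDr mulrCA.
by rewrite big_split /= -mulr_suml mu1 -mulr_sumr; lra.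
Qed.

(** * Comparison of the two policies *)

(** The induction step given the request [s]. The comparison for the remaining [m] steps is a
    hypothesis, so that the lemma also serves the first request, which has no predecessor. *)
Lemma request_comparison (R : realType) (n k : nat) (I : markov_paging R n k)
    (A O : policy R n) (m : nat) (h h' : history n) (s : 'I_n)
    (f : {perm 'I_n}) :
    dominating_distribution_algorithm I A -> online_policy I O ->
    feasible I h -> feasible I h' ->
    matching (cache I h) (cache I h') f ->
    (forall x, x \notin cache I h -> x \notin cache I h' -> f x = x) ->
    (forall e e' g, feasible I ((s, e) :: h) -> feasible I ((s, e') :: h') ->
      matching (cache I ((s, e) :: h)) (cache I ((s, e') :: h')) g ->
      cost_to_go I A m ((s, e) :: h) <= 2 * cost_to_go I O m ((s, e') :: h') +
        2 * matching_cost (fun p q => alpha I p q s)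
              (cache I ((s, e) :: h)) g) ->
  (if s \in cache I h then cost_to_go I A m ((s, None) :: h)
   else 1 + \sum_(p in cache I h)
              A h s p * cost_to_go I A m ((s, Some p) :: h)) <=
  2 * (if s \in cache I h' then cost_to_go I O m ((s, None) :: h')
       else 1 + \sum_(p in cache I h')
                  O h' s p * cost_to_go I O m ((s, Some p) :: h')) +
  2 * matching_cost (alpha_from I s) (cache I h) f.
Proof.
move=> Adom Oon fh fh' fAO ffix IH.
set cA := cache I h in fAO ffix *; set cO := cache I h' in fAO ffix *.
pose a p q := alpha I p q s.
have fO x : x \notin cA -> f x \notin cO by rewrite fAO.
have [sA|sA] := ifPn; have [sO|sO] := ifPn.
- have -> : matching_cost (alpha_from I s) cA f = matching_cost a cA f.
    apply: eq_bigr => x xA; rewrite /alpha_from.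
    have [sx|_] := eqVneq s (f x); first by move: (fO x xA); rewrite -sx sO.
    by have [sx|//] := eqVneq s x; move: xA; rewrite -sx sA.
  by apply: IH; rewrite /= ?fh ?fh'.
(* Only [O] misses: the term of the page matched with [s] grows by at most 1, and the other terms
   are unchanged. *)
- set vO := \sum_(r in cO) _; set vA := cost_to_go _ _ _ _.
  set cost := matching_cost _ _ _.
  suff : vA - 2 * cost - 2 <= 2 * vO by lra.
  rewrite /vO [leRHS]mulr_sumr; under eq_bigr => r _ do rewrite mulrCA.
  apply: le_distr_mean; first exact: Oon.
  move=> r rO; set vr := cost_to_go _ _ _ _.
  suff : vA <= 2 * vr + 2 * (1 + cost) by lra.
  apply: (le_trans (IH None (Some r) (f * tperm s r)%g _ _ _)) => /=.
  + by rewrite fh.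
  + by rewrite fh' sO.
  + exact: matching_replacer.
  rewrite lerD2l ler_wpM2l// /cost.
  pose y := (f^-1)%g s; have fy : f y = s by rewrite permKV.
  have yA : y \notin cA by rewrite -fAO fy.
  rewrite /matching_cost (bigD1 y)// [X in _ <= _ + X](bigD1 y)//= addrA.
  apply: lerD.
    by apply: (le_trans (alpha_le1 I _ _ _)); rewrite lerDl alpha_from_ge0.
  apply: ler_sum => x /andP[xA xy]; rewrite permM /alpha_from.
  have fxs : s != f x by rewrite -fy (inj_eq perm_inj) eq_sym.
  have fxr : r != f x by apply: contraNneq (fO x xA) => <-.
  rewrite tpermD// (negbTE fxs).
  by have [sx|//] := eqVneq s x; move: xA; rewrite -sx sA.
all: pose rest := \sum_(x | (x \notin cA) && (x != s)) a x (f x).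
all: have dom := Adom h s fh sA.
- have fxs x : x \notin cA -> s != f x.
    by move=> xA; apply: contraNneq (fO x xA) => <-.
  have -> : matching_cost (alpha_from I s) cA f = 1 + rest.
    rewrite /matching_cost (bigD1 s)//= {1}/alpha_from eqxx (negbTE (fxs s _))//.
    congr (_ + _); apply: eq_bigr => x /andP[xA xs].
    by rewrite /alpha_from (negbTE (fxs x xA)) eq_sym (negbTE xs).
  (* Only [A] misses. If [f s] were missing from both caches, [f] would fix it, and injectivity
     would give [f s = s]. *)
  have fsA : f s \in cA.
    apply: contraT => fsA; case/eqP: (fxs s sA); apply: (@perm_inj _ f).
    by rewrite [RHS]ffix ?fO.
  set vO := cost_to_go _ _ _ _.
  suff : \sum_(p in cA) A h s p * cost_to_go I A m ((s, Some p) :: h) <=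
      2 * vO + 2 * rest + 1 by lra.
  apply: (dominating_mean_le dom fsA) => p pA.
  apply: (le_trans (IH (Some p) None (tperm s p * f)%g _ _ _)) => /=.
  + by rewrite fh sA.
  + by rewrite fh'.
  + exact: matching_replacel.
  rewrite matching_cost_replace// permM tpermR -/vO.
  set rest' := \sum_(x | _) _.
  have -> : rest' = rest.
    apply: eq_bigr => x /andP[xA xs]; rewrite permM tpermD 1?eq_sym//.
    by apply: contraNneq xA => ->.
  by rewrite /a; lra.
- have fs : f s = s by exact: ffix.
  have fxs x : x != s -> s != f x by rewrite -{2}fs (inj_eq perm_inj) eq_sym.
  have -> : matching_cost (alpha_from I s) cA f = rest.
    rewrite /matching_cost (bigD1 s)//= fs alpha_from_refl add0r.
    apply: eq_bigr => x /andP[xA xs].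
    by rewrite /alpha_from (negbTE (fxs x xs)) eq_sym (negbTE xs).
  set vO := \sum_(r in cO) _; set vA := \sum_(p in cA) _.
  suff : vA - 2 * rest - 1 <= 2 * vO by lra.
  rewrite /vO [leRHS]mulr_sumr; under eq_bigr => r _ do rewrite mulrCA.
  apply: le_distr_mean; first exact: Oon.
  move=> r rO; set vr := cost_to_go _ _ _ _.
  (* Both miss. The partner [q] of the evicted page has to lie in [cA] for domination to apply; for
     [f r] this follows from [ffix], as for [f s] above. *)
  pose q := if r \in cA then r else f r.
  have qA : q \in cA.
    rewrite /q; case: ifPn => // rA; apply: contraT => frA; move: (fO r rA).
    by rewrite (@perm_inj _ f _ _ (ffix _ frA (fO r rA))) rO.
  have : vA <= 2 * vr + 2 * rest + 1; last by lra.
  apply: (dominating_mean_le dom qA) => p pA.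
  have fhp : feasible I ((s, Some p) :: h) by rewrite /= fh sA.
  have fhr : feasible I ((s, Some r) :: h') by rewrite /= fh' sO.
  pose g : {perm 'I_n} := (tperm s p * f * tperm s r)%g.
  have mg : matching (s |: (cA :\ p)) (s |: (cO :\ r)) g.
    exact: matching_replace.
  have gp : g p = r by rewrite /g !permM tpermR fs tpermL.
  have gE x : x \notin cA -> x != s -> g x = f x.
    move=> xA xs; rewrite /g !permM (@tpermD _ s p x) 1?eq_sym//; last first.
      by apply: contraNneq xA => ->.
    by rewrite tpermD ?fxs//; apply: contraNneq (fO x xA) => <-.
  have [rA|rA] := boolP (r \in cA).
    apply: (le_trans (IH _ _ _ fhp fhr mg)) => /=.
    rewrite matching_cost_replace// gp -/vr /q rA.
    set rest' := \sum_(x | _) _.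
    have -> : rest' = rest.
      by apply: eq_bigr => x /andP[xA xs]; rewrite gE.
    by rewrite /a; lra.
  (* After the evictions p is matched with r, and r with f r; composing the
     two as in [matching_fix] matches p with f r, which A has in its cache. *)
  have rs : r != s by apply: contraNneq sO => <-.
  have rp : r != p by apply: contraNneq rA => ->.
  pose g' : {perm 'I_n} := (tperm p r * g)%g.
  have mg' : matching (s |: (cA :\ p)) (s |: (cO :\ r)) g'.
    apply: matching_tperm => //.
      by rewrite !inE eqxx orbF; apply: contraNneq sA => <-.
    by rewrite !inE negb_or rs negb_and rA orbT.
  apply: (le_trans (IH _ _ _ fhp fhr mg')) => /=.
  have g'p : g' p = f r by rewrite permM tpermL gE.
  have g'r : g' r = r by rewrite permM tpermR gp.
  rewrite matching_cost_replace// g'p -/vr /q (negbTE rA).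
  set rest' := \sum_(x | _) _.
  (* Only the term of [r] changes: it drops to 0. *)
  have : rest' <= rest.
    apply: ler_sum => x /andP[xA xs].
    have [->|xr] := eqVneq x r; first by rewrite g'r alpha_refl alpha_ge0.
    rewrite permM tpermD 1?eq_sym ?gE//.
    by apply: contraNneq xA => ->.
  by rewrite /a; lra.
Qed.

Lemma cost_comparison (R : realType) (n k : nat) (I : markov_paging R n k)
    (A O : policy R n) (m : nat) (h h' : history n) (s : 'I_n)
    (e e' : option 'I_n) (f : {perm 'I_n}) :
  dominating_distribution_algorithm I A -> online_policy I O ->
  feasible I ((s, e) :: h) -> feasible I ((s, e') :: h') ->
  matching (cache I ((s, e) :: h)) (cache I ((s, e') :: h')) f ->
  cost_to_go I A m ((s, e) :: h) <= 2 * cost_to_go I O m ((s, e') :: h') +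
    2 * matching_cost (fun p q => alpha I p q s) (cache I ((s, e) :: h)) f.
Proof.
move=> Adom Oon; elim: m h h' s e e' f => [|m IH] h h' s e e' f fh fh' fAO.
  rewrite mulr0 add0r mulr_ge0// sumr_ge0// => x _; exact: alpha_ge0.
(* [request_comparison] needs the pages missing from both caches to be fixed. *)
have [g [gAO gfix gf]] := matching_fix (fun x => alpha_refl I x s)
  (fun x y z => alpha_triangle I x y z s) fAO.
set H := (s, e) :: h; set H' := (s, e') :: h'.
apply: (@le_trans _ _ (2 * cost_to_go I O m.+1 H' +
  2 * matching_cost (fun p q => alpha I p q s) (cache I H) g)); last first.
  by rewrite lerD2l ler_wpM2l.
have -> : matching_cost (fun p q => alpha I p q s) (cache I H) g =
    \sum_t request_prob I H t * matching_cost (alpha_from I t) (cache I H) g.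
  under [RHS]eq_bigr => t _ do rewrite mulr_sumr.
  by rewrite exchange_big; apply: eq_bigr => x _; rewrite alphaE.
rewrite /cost_to_go -/cost_to_go !mulr_sumr -big_split.
apply: ler_sum => t _; rewrite !(mulrCA 2) -[leRHS]mulrDr.
apply: ler_wpM2l; first exact: trans_ge0.
apply: (@request_comparison _ _ _ I A O m H H' t g) => // *; exact: IH.
Qed.

Theorem theorem1 (R : realType) (n k : nat) (I : markov_paging R n k)
    (A_dom : policy R n) :
  dominating_distribution_algorithm I A_dom -> competitive I 2 A_dom.
Proof.
move=> Adom [//|m] _ O [Oon _].
have Aon : online_policy I A_dom by move=> h s fh sh; have [] := Adom h s fh sh.
rewrite !expected_cost_to_go//= mulr_sumr; apply: ler_sum => s _.
rewrite mulrCA; apply: ler_wpM2l; first exact: init_ge0.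
(* Both runs start from the same cache, so the identity matching gives zero potential whatever the
   first request is. *)
have id_cost : matching_cost (alpha_from I s) (cache0 I) 1%g = 0.
  by apply: big1 => x _; rewrite perm1 alpha_from_refl.
rewrite -[leRHS]addr0 -[X in _ <= _ + X](mulr0 2) -[X in _ <= _ + _ * X]id_cost.
apply: (@request_comparison _ _ _ I A_dom O m [::] [::] s 1%g) => //.
- by move=> x; rewrite perm1.
- by move=> x _ _; rewrite perm1.
by move=> *; exact: cost_comparison.
Qed.
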